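(* Let $f,g:X\to Y$ be fibrewise pointed maps between fibrewise pointed spaces over a topological space $B$, where $X$ and $Y$ are fibrant. If, in addition, $X$ and $Y$ are ANR spaces and $B$ is a LEC space, then $$D_B(f,g)\le D_B^B(f,g)\le D_B(f,g)+1.$$
   Context: Fix a topological space $B$ and let $I=[0,1]$. A fibrewise pointed space over $B$ is a space $X$ with continuous maps $p_X:X\to B$, $s_X:B\to X$ such that $p_X\circ s_X=id_B$; it is fibrant if $p_X$ is a Hurewicz fibration. A fibrewise map $f:X\to Y$ is a continuous map with $p_Y\circ f=p_X$; it is fibrewise pointed if moreover $f\circ s_X=s_Y$. Subspaces $U\subset X$ are fibrewise spaces via $p_X|_U$, and fibrewise pointed if $s_X(B)\subset U$. A fibrewise homotopy ($\simeq_B$) is a homotopy $H:X\times I\to Y$ between fibrewise maps with $p_Y(H(x,t))=p_X(x)$; it is a fibrewise pointed homotopy ($\simeq^B_B$) if moreover $H(s_X(b),t)=s_Y(b)$ for all $b,t$. $D_B(f,g)$ is the smallest integer $n\ge0$ such that $X$ has an open cover $\{U_0,\dots,U_n\}$ with $f|_{U_i}\simeq_B g|_{U_i}$ for all $i$ ($\infty$ if none exists). $D_B^B(f,g)$ is the smallest integer $n\ge0$ such that $X$ has an open cover $\{U_0,\dots,U_n\}$ with $s_X(B)\subset U_i$ and $f|_{U_i}\simeq^B_B g|_{U_i}$ for all $i$ ($\infty$ if none exists). ANR means absolute neighborhood retract (for metrizable spaces). A LEC (locally equiconnected) space is a space $B$ whose diagonal map $B\to B\times B$ is a closed cofibration.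 *)

(* Defs.v *)
From HB Require Import structures.
From mathcomp Require Import all_boot all_order all_algebra.
From mathcomp Require Import all_classical all_reals all_analysis.

Set Implicit Arguments.
Unset Strict Implicit.
Unset Printing Implicit Defensive.

Import Order.TTheory GRing.Theory Num.Theory.
Import numFieldTopology.Exports numFieldNormedType.Exports.

Local Open Scope classical_set_scope.
Local Open Scope ring_scope.

(* A homotopy on [U] is a total function [X * R -> Y] of which only the
   restriction to [U `*` unit_itv R] matters: {within _, continuous _} refers
   to the subspace topology and ignores the values elsewhere. Whenever a
   homotopy is asserted to exist, a map [X -> Y] is available, so that allowing
   only total functions costs nothing. *)
Definition unit_itv (R : realType) : set R := `[0, 1].
Arguments unit_itv : clear implicits.

Definition homotopy_cts (R : realType) (X Y : topologicalType) (U : set X)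
    (H : X * R -> Y) : Prop :=
  {within U `*` unit_itv R, continuous H}.

Definition hurewicz_fibration (R : realType) (E B : topologicalType)
    (p : E -> B) : Prop :=
  continuous p /\
  forall (Z : topologicalType) (h : Z -> E) (H : Z * R -> B),
    continuous h -> homotopy_cts setT H ->
    (forall z, H (z, 0) = p (h z)) ->
    exists K : Z * R -> E,
      [/\ homotopy_cts setT K,
          forall z, K (z, 0) = h z
        & forall z t, unit_itv R t -> p (K (z, t)) = H (z, t)].

Definition cofibration (R : realType) (A X : topologicalType)
    (j : A -> X) : Prop :=
  continuous j /\
  forall (Z : topologicalType) (h : X -> Z) (H : A * R -> Z),
    continuous h -> homotopy_cts setT H ->
    (forall a, H (a, 0) = h (j a)) ->
    exists K : X * R -> Z,
      [/\ homotopy_cts setT K,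
          forall x, K (x, 0) = h x
        & forall a t, unit_itv R t -> K (j a, t) = H (a, t)].

Definition closed_cofibration (R : realType) (A X : topologicalType)
    (j : A -> X) : Prop :=
  cofibration R j /\ closed (range j).

Definition LEC (R : realType) (B : topologicalType) : Prop :=
  closed_cofibration R (fun b : B => (b, b)).

(* Nonnegativity of [d] follows from the three axioms below. *)
Definition metrizable (R : realType) (T : topologicalType) : Prop :=
  exists d : T -> T -> R,
    [/\ forall x y, d x y = 0 <-> x = y,
        forall x y, d x y = d y x,
        forall x y z, d x z <= d x y + d y z
      & forall (x : T) (A : set T),
          nbhs x A <-> exists2 e : R, 0 < e & [set y | d x y < e] `<=` A].

Definition closed_embedding (X Z : topologicalType) (i : X -> Z) : Prop :=
  [/\ continuous i, injective i & forall A, closed A -> closed (i @` A)].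

(* The retraction takes its values in [Z], and is constrained to land in [A];
   a function [Z -> X] would rule out the case of an empty [X] in [ANR]. *)
Definition neighborhood_retract (Z : topologicalType) (A : set Z) : Prop :=
  exists (U : set Z) (r : Z -> Z),
    [/\ open U, A `<=` U, {within U, continuous r}, r @` U `<=` A
      & forall z, A z -> r z = z].

Definition ANR (R : realType) (X : topologicalType) : Prop :=
  metrizable R X /\
  forall (Z : topologicalType) (i : X -> Z),
    metrizable R Z -> closed_embedding i -> neighborhood_retract (range i).

Record fwPointedSpace (B : topologicalType) := FwPointedSpace {
  fw_space :> topologicalType;
  fw_proj : fw_space -> B;
  fw_sec : B -> fw_space;
  fw_proj_continuous : continuous fw_proj;
  fw_sec_continuous : continuous fw_sec;
  fw_secK : forall b, fw_proj (fw_sec b) = b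
}.

Section Fibrewise.
Context (R : realType) (B : topologicalType).
Implicit Types X Y : fwPointedSpace B.

Definition fibrant X : Prop := hurewicz_fibration R (@fw_proj B X).

Definition fw_map X Y (f : X -> Y) : Prop :=
  continuous f /\ forall x, fw_proj (f x) = fw_proj x.

Definition fw_pointed_map X Y (f : X -> Y) : Prop :=
  fw_map f /\ forall b, f (fw_sec X b) = fw_sec Y b.

Definition fw_homotopy_on X Y (U : set X) (f g : X -> Y) (H : X * R -> Y) :
    Prop :=
  [/\ homotopy_cts U H,
      forall x, U x -> H (x, 0) = f x,
      forall x, U x -> H (x, 1) = g x
    & forall x t, U x -> unit_itv R t -> fw_proj (H (x, t)) = fw_proj x].

Definition fw_homotopic_on X Y (U : set X) (f g : X -> Y) : Prop :=
  exists H : X * R -> Y, fw_homotopy_on U f g H.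

Definition fw_pointed_homotopic_on X Y (U : set X) (f g : X -> Y) : Prop :=
  exists H : X * R -> Y,
    fw_homotopy_on U f g H /\
    forall b t, unit_itv R t -> H (fw_sec X b, t) = fw_sec Y b.

Definition open_cover (T : topologicalType) n (U : 'I_n.+1 -> set T) : Prop :=
  (forall i, open (U i)) /\ \bigcup_i U i = setT.

Definition least_or_infty (P : nat -> Prop) : \bar R :=
  match pselect (exists n, `[< P n >]) with
  | left exP => (ex_minn exP)%:R%:E
  | right _ => +oo%E
  end.

Definition fw_distance X Y (f g : X -> Y) : \bar R :=
  least_or_infty (fun n => exists U : 'I_n.+1 -> set X,
    open_cover U /\ forall i, fw_homotopic_on (U i) f g).

Definition fw_pointed_distance X Y (f g : X -> Y) : \bar R :=
  least_or_infty (fun n => exists U : 'I_n.+1 -> set X,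
    open_cover U /\
    forall i, range (fw_sec X) `<=` U i /\ fw_pointed_homotopic_on (U i) f g).

End Fibrewise.

Arguments fw_distance R {B X Y} f g.
Arguments fw_pointed_distance R {B X Y} f g.

(* Main.v *)
Require Import Defs.
From HB Require Import structures.
From mathcomp Require Import all_boot all_order all_algebra.
From mathcomp Require Import all_classical all_reals all_analysis.
From mathcomp Require Import lra ring.

Set Implicit Arguments.
Unset Strict Implicit.
Unset Printing Implicit Defensive.

Import Order.TTheory GRing.Theory Num.Theory.
Import numFieldTopology.Exports numFieldNormedType.Exports.

Local Open Scope classical_set_scope.
Local Open Scope ring_scope.

(** The first inequality holds because a pointed homotopy is in particular a
    homotopy. For the second, the point is that [f] and [g] are already
    fibrewise pointed homotopic over some open neighbourhood [M] of the section
    of [X] ([local_pointed_homotopy]). Given this, let [U_0, ..., U_n] be an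
    open cover with fibrewise homotopies. Since [X] is metrizable, the section
    and the complement of [M] have disjoint open neighbourhoods [N] and [G]
    ([metrizable_normal]). The sets [(U_i `&` G) `|` N] together with [M] cover
    [X], which costs one set more; on the open piece [N] one uses the
    homotopy of [M], on the disjoint open piece [U_i `&` G] the given one, which
    never meets the section ([pointed_homotopic_glue]).

    The neighbourhood [M] is obtained as follows. An ANR [Y] is equiconnected
    near its diagonal: close points [y], [y'] are joined by a path
    [l (y, y', t)], continuous in all variables and constant when [y = y']
    ([ANR_equiconnected]). As [f] and [g] agree on the section, the paths
    [t |-> l (f x, g x, t)] are defined for [x] near the section, and constant
    on it, but they leave the fibre. The map [l] also gives short paths in the
    base, from [b] to [b'], namely [u |-> p (l (s b, s b', u))], where
    [p] and [s] are the projection and the section of [Y]. Every point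
    [l (f x, g x, t)] is pushed back into the fibre over the projection of [x]
    by lifting such a path. The push must not move points which lie in the
    correct fibre already, both to keep [f x] and [g x] as end points and to
    keep the homotopy pointed. This is possible because a fibration lets
    constant paths be lifted to constant paths whenever constancy is detected by
    the zeros of a continuous function ([regular_lift]), here the distance in
    [Y] between two points of the section.

    The equiconnection of an ANR [Y] with metric [d] comes from the embedding
    [y |-> d y] into the real functions on [Y]: in the sup metric the chords
    between the points [d y] form a metric space in which [Y] is closed, so a
    neighbourhood of [Y] in that space retracts to [Y], and it contains the
    chords between close points. *)

(** * Continuity on a subset *)

Lemma within_comp (X Y Z : topologicalType) (A : set X) (C : set Y)
    (f : X -> Y) (g : Y -> Z) :
  {within A, continuous f} -> (forall x, A x -> C (f x)) ->
  {within C, continuous g} -> {within A, continuous (fun x => g (f x))}.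
Proof.
move=> /subspace_continuousP cf AC /subspace_continuousP cg.
apply/subspace_continuousP => x Ax N /(cg _ (AC _ Ax)) /= gN.
have := cf _ Ax _ gN; rewrite /within /= !nbhs_simpl /=.
by apply: filterS => y h Ay; exact: h (AC _ Ay).
Qed.

Lemma within_pair (X Y Z : topologicalType) (A : set X)
    (f : X -> Y) (g : X -> Z) :
  {within A, continuous f} -> {within A, continuous g} ->
  {within A, continuous (fun x => (f x, g x))}.
Proof.
move=> /subspace_continuousP cf /subspace_continuousP cg.
by apply/subspace_continuousP => x Ax; apply: cvg_pair; [exact: cf|exact: cg].
Qed.

Lemma within_eq (X Y : topologicalType) (A : set X) (f g : X -> Y) :
  (forall x, A x -> f x = g x) ->
  {within A, continuous f} -> {within A, continuous g}.
Proof.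
by move=> fg; apply: subspace_eq_continuous => x /set_mem; exact: fg.
Qed.

Lemma within_cts_comp (X Y Z : topologicalType) (A : set X)
    (f : X -> Y) (g : Y -> Z) :
  {within A, continuous f} -> continuous g ->
  {within A, continuous (fun x => g (f x))}.
Proof.
move=> cf cg; apply: (within_comp (C := setT)) => //.
exact: continuous_subspaceT.
Qed.

Lemma within_fst (X Y : topologicalType) (A : set (X * Y)) :
  {within A, continuous fst}.
Proof. by apply: continuous_subspaceT => z; exact: cvg_fst. Qed.

Lemma within_snd (X Y : topologicalType) (A : set (X * Y)) :
  {within A, continuous snd}.
Proof. by apply: continuous_subspaceT => z; exact: cvg_snd. Qed.

Lemma within_near (X : topologicalType) (A : set X) (x : X) (P : set X) :
  nbhs x P -> \forall y \near within A (nbhs x), P y.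
Proof. by apply: filterS => y Py _. Qed.

Lemma unit_itv0 (R : realType) : unit_itv R 0.
Proof. by rewrite /unit_itv /= in_itv /= lexx ler01. Qed.

Lemma unit_itv1 (R : realType) : unit_itv R 1.
Proof. by rewrite /unit_itv /= in_itv /= lexx ler01. Qed.

Lemma unit_itvP (R : realType) (t : R) : unit_itv R t <-> 0 <= t <= 1.
Proof. by rewrite /unit_itv /= in_itv. Qed.

(** The tube lemma for the interval, relative to a subset of the base. *)
Lemma within_tube (R : realType) (X : topologicalType) (A : set X) (x0 : X)
    (P : X * R -> Prop) :
  (forall u, unit_itv R u ->
     \forall z \near within (A `*` unit_itv R) (nbhs (x0, u)), P z) ->
  \forall x \near within A (nbhs x0), forall u, unit_itv R u -> P (x, u).
Proof.
move=> h; have /compact_near_coveringP/near_covering_withinP :=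
  @segment_compact R 0 1.
move=> /(_ X (within A (nbhs x0)) (fun x u => P (x, u))).
apply=> u /h; rewrite /within /= => -[[U V] [/= Ux Vu] UV].
exists (V, A `&` U).
  by split=> //=; apply: filterS Ux => x Ux Ax.
by move=> [v x] /= [Vv [Ax Ux']] Iv; apply: (UV (x, v)).
Qed.

Lemma tube (R : realType) (X : topologicalType) (x0 : X) (P : X * R -> Prop) :
  (forall u, unit_itv R u -> \forall z \near (x0, u), P z) ->
  \forall x \near x0, forall u, unit_itv R u -> P (x, u).
Proof.
move=> h.
have : nbhs x0 [set x | setT x -> forall u, unit_itv R u -> P (x, u)].
  apply: (@within_tube R X setT x0 P) => u /h Pu.
  exact: within_near.
have F0 : Filter (nbhs x0) by exact: nbhs_filter.
move=> H; apply: (@filterS _ _ F0 _ _ _ H) => x; exact.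
Qed.

(** * Regular liftings *)

Lemma nbhs_in_subspace (X : topologicalType) (A : set X) (x : X) (U : set X) :
  A x -> nbhs (x : subspace A) U = within A (nbhs x) U.
Proof. by move=> Ax; rewrite (nbhs_subspace_in Ax). Qed.

Lemma nbhs_out_subspace (X : topologicalType) (A : set X) (x : X) :
  ~ A x -> nbhs (x : subspace A) [set x].
Proof.
move=> Ax; suff : nbhs_subspace (x : subspace A) [set x] by [].
by rewrite -nbhs_subspace_out.
Qed.

(** The homotopy lifting property is stated for total spaces; it passes to a
    subset [A] of [Z] because [subspace A] is a space with underlying type [Z]
    whose points outside [A] are isolated, so that the data may be
    extended there by constant homotopies. *)
Lemma hurewicz_within (R : realType) (E B Z : topologicalType) (p : E -> B)
    (A : set Z) (h : Z -> E) (H : Z * R -> B) :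
  hurewicz_fibration R p -> {within A, continuous h} -> homotopy_cts A H ->
  (forall z, A z -> H (z, 0) = p (h z)) ->
  exists K : Z * R -> E,
    [/\ homotopy_cts A K, forall z, A z -> K (z, 0) = h z
      & forall z t, A z -> unit_itv R t -> p (K (z, t)) = H (z, t)].
Proof.
move=> [cp lift] ch /subspace_continuousP cH H0.
pose H' (w : subspace A * R) := if `[< A w.1 >] then H w else p (h w.1).
have H'E z t : A z -> H' (z, t) = H (z, t) by move=> Az; rewrite /H' asboolT.
have [] := lift (subspace A) h H' ch.
- apply/subspace_continuousP => -[z t] [_ /= It] N; rewrite /from_subspace.
  have [Az|nAz] := pselect (A z).
    rewrite H'E// => /(cH (z, t) (conj Az It)).
    rewrite /within /= !nbhs_simpl /=.
    move=> -[[U V] [/= Uz Vt] UV]; exists (A `&` U, V).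
      by split=> //=; rewrite nbhs_in_subspace//; apply: filterS Uz => y Uy Ay.
    by move=> [y u] /= [[Ay Uy] Vu] [_ Iu]; rewrite H'E//; exact: (UV (y, u)).
  move=> N0; rewrite /within /= !nbhs_simpl /=; exists ([set z], setT).
    by split=> //=; [exact: nbhs_out_subspace|exact: filterT].
  move=> [y u] /= [-> _] _; move: N0; rewrite /H' asboolF//=.
  exact: nbhs_singleton.
- by move=> z; rewrite /H' /=; case: asboolP => // /H0.
move=> K [/subspace_continuousP cK K0 KH]; exists K; split => //.
- apply/subspace_continuousP => -[z t] [/= Az It] N /(cK (z, t) (conj I It)).
  rewrite /within /= !nbhs_simpl /= => -[[U V] [/= Uz Vt] UV].
  move: Uz; rewrite nbhs_in_subspace// => Uz.
  exists ([set x | A x -> U x], V) => // -[y u] /= [AU Vu] [Ay Iu].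
  by apply: (UV (y, u)) => //; split=> //; exact: AU.
- by move=> z t Az It; rewrite KH// H'E.
Qed.

(** Hurewicz's construction of regular liftings: run the homotopy through the
    point [z] within time [delta z], lift, and read the lift at speed [delta z].
    Where [delta] vanishes the lift is read only at time 0 and is constant. *)
Lemma regular_lift (R : realType) (E B Z : topologicalType) (p : E -> B)
    (A : set Z) (delta : Z -> R) (h : Z -> E) (H : Z * R -> B) :
  hurewicz_fibration R p ->
  {within A, continuous delta} -> (forall z, A z -> unit_itv R (delta z)) ->
  {within A, continuous h} -> homotopy_cts A H ->
  (forall z, A z -> H (z, 0) = p (h z)) ->
  (forall z t, A z -> unit_itv R t -> delta z = 0 -> H (z, t) = p (h z)) ->
  exists K : Z * R -> E,
    [/\ homotopy_cts A K, forall z, A z -> K (z, 0) = h z,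
        forall z t, A z -> unit_itv R t -> p (K (z, t)) = H (z, t)
      & forall z t, A z -> unit_itv R t -> delta z = 0 -> K (z, t) = h z].
Proof.
move=> fibp cd d01 ch cH H0 Hst.
have cd1 : {within A `*` unit_itv R, continuous (fun w => delta w.1)}.
  apply: within_comp cd; first exact: within_fst.
  by move=> w [].
have dI w : (A `*` unit_itv R) w -> unit_itv R (w.2 * delta w.1).
  move=> [/d01 /unit_itvP/andP[d0 d1] /unit_itvP/andP[t0 t1]].
  by apply/unit_itvP; rewrite mulr_ge0// mulr_ile1.
(* When [delta z = 0] the quotient is 0 by convention, so [H'] stays at the
   initial point of [H], as it should. *)
pose tau (w : Z * R) := Num.min 1 (w.2 / delta w.1).
have tau01 w : (A `*` unit_itv R) w -> unit_itv R (tau w).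
  move=> [/d01 /unit_itvP/andP[d0 _] /unit_itvP/andP[t0 _]]; apply/unit_itvP.
  by rewrite le_min ler01 divr_ge0//= ge_min lexx.
pose H' (w : Z * R) := H (w.1, tau w).
have cH' : homotopy_cts A H'.
  apply/subspace_continuousP => -[z t] [/= Az It].
  have [dz0|dz0] := eqVneq (delta z) 0.
    (* [H] is constant through [z], hence nearly so through nearby points by
       the tube lemma: the discontinuity of [tau] at [z] is harmless. *)
    rewrite /from_subspace {2}/H' Hst//; last exact: (tau01 (z, t)).
    move=> N phN.
    have : \forall y \near within A (nbhs z),
        forall u, unit_itv R u -> N (H (y, u)).
      apply: (@within_tube R Z A z (fun w => N (H w))) => u Iu.
      move/subspace_continuousP : cH => /(_ (z, u) (conj Az Iu)).
      by apply; rewrite /from_subspace // Hst.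
    rewrite /within /= !nbhs_simpl /= => nN.
    exists ([set y | A y -> forall u, unit_itv R u -> N (H (y, u))], setT).
      by split => //=; exact: filterT.
    by move=> [y u] /= [Hy _] [Ay Iu]; apply: Hy => //; exact: (tau01 (y, u)).
  have c2 : (fun w => (w.1, tau w)) @ within (A `*` unit_itv R) (nbhs (z, t))
      --> (z, tau (z, t)).
    apply: (@cvg_pair _ _ _ _ (nbhs z) (nbhs (tau (z, t)))).
      by apply: cvg_within_filter; exact: cvg_fst.
    apply: (@continuous2_cvg _ R R R).
    - exact: (@min_continuous _ R (1, _)).
    - exact: cvg_cst.
    apply: cvgM; first by apply: cvg_within_filter; exact: cvg_snd.
    apply: cvgV => //.
    by move/subspace_continuousP : cd1 => /(_ (z, t) (conj Az It)).
  move=> N /=; rewrite /from_subspace {1}/H' /= => HN.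
  have It' := tau01 (z, t) (conj Az It).
  move/subspace_continuousP : cH => /(_ (z, tau (z, t)) (conj Az It') _ HN).
  rewrite /from_subspace /= /within /= !nbhs_simpl /= => /c2.
  rewrite /= /within /= !nbhs_simpl /=.
  apply: filterS => w wN [Aw Iw]; apply: wN => //; split => //=; exact: tau01.
have [] := hurewicz_within fibp ch cH'.
  by move=> z Az; rewrite /H' /tau /= mul0r min_r// H0.
move=> K [cK K0 KH].
exists (fun w => K (w.1, w.2 * delta w.1)); split.
- have := @within_comp (Z * R)%type (Z * R)%type E (A `*` unit_itv R)
    (A `*` unit_itv R) (fun w => (w.1, w.2 * delta w.1)) K.
  apply; last exact: cK.
    apply: within_pair.
      exact: within_fst.
    apply/subspace_continuousP => w Aw.
    apply: cvgM; first by apply: cvg_within_filter; exact: cvg_snd.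
    by move/subspace_continuousP : cd1; exact.
  by move=> w Aw; split; [case: Aw|exact: dI].
- by move=> z Az; rewrite /= mul0r K0.
- move=> z t Az It /=; rewrite KH//; last exact: (dI (z, t)).
  rewrite /H' /tau /=.
  have [dz0|dz0] := eqVneq (delta z) 0.
    by rewrite dz0 mulr0 mul0r min_r// H0// Hst.
  rewrite mulfK// min_r//; first by case/unit_itvP/andP: It.
- by move=> z t Az It dz0; rewrite /= dz0 mulr0 K0.
Qed.

(** * Metrics *)

Definition metrizes (R : realType) (T : topologicalType) (d : T -> T -> R) :=
  [/\ forall x y, d x y = 0 <-> x = y,
      forall x y, d x y = d y x,
      forall x y z, d x z <= d x y + d y z
    & forall (x : T) (A : set T),
        nbhs x A <-> exists2 e : R, 0 < e & [set y | d x y < e] `<=` A].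

Section Metrizes.
Context (R : realType) (T : topologicalType) (d : T -> T -> R).
Context (md : metrizes d).

Lemma dist_eq0 x y : d x y = 0 -> x = y. Proof. by case: md => h _ _ _ /h. Qed.

Lemma distxx x : d x x = 0. Proof. by case: md => h _ _ _; apply/h. Qed.

Lemma distC x y : d x y = d y x. Proof. by case: md. Qed.

Lemma dist_triangle x y z : d x z <= d x y + d y z. Proof. by case: md. Qed.

Lemma dist_ge0 x y : 0 <= d x y.
Proof. by have := dist_triangle x y x; rewrite distxx (distC y x); lra. Qed.

Lemma nbhs_dist (x : T) (A : set T) :
  nbhs x A <-> exists2 e : R, 0 < e & [set y | d x y < e] `<=` A.
Proof. by case: md. Qed.

Lemma nbhs_dist_lt (x : T) (e : R) : 0 < e -> nbhs x [set y | d x y < e].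
Proof. by move=> e0; apply/nbhs_dist; exists e. Qed.

Lemma dist_lipschitz x y z : `|d x z - d y z| <= d x y.
Proof.
rewrite ler_norml; have := dist_triangle x y z; have := dist_triangle y x z.
by rewrite (distC y x); lra.
Qed.

Lemma dist_continuous : continuous (fun w : T * T => d w.1 w.2).
Proof.
move=> [x y]; apply/(@cvgrPdist_lt R R^o) => e e0 /=.
have e2 : 0 < e / 2 by lra.
exists ([set z | d x z < e / 2], [set z | d y z < e / 2]).
  by split; exact: nbhs_dist_lt.
move=> [x' y'] /= [xx' yy'].
have := dist_lipschitz x x' y; have := dist_lipschitz y y' x'.
rewrite (distC y x') (distC y' x') !ler_norml ltr_norml; lra.
Qed.

End Metrizes.

(** Clamping the parameter makes every chord defined for all real parameters, so
    that the maps below are continuous without restriction to the interval. *)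
Definition clamp (R : realType) (t : R) : R := Num.max 0 (Num.min 1 t).

Lemma clamp_itv (R : realType) (t : R) : 0 <= clamp t <= 1.
Proof. by rewrite /clamp le_max lexx ge_max ler01 ge_min lexx. Qed.

Lemma clamp_id (R : realType) (t : R) : unit_itv R t -> clamp t = t.
Proof. by move=> /unit_itvP/andP[t0 t1]; rewrite /clamp min_r// max_r. Qed.

Lemma clamp_continuous (R : realType) : continuous (@clamp R).
Proof.
move=> t; apply: (@continuous2_cvg _ R R R).
- exact: (@max_continuous _ R (0, _)).
- exact: cvg_cst.
apply: (@continuous2_cvg _ R R R).
- exact: (@min_continuous _ R (1, _)).
- exact: cvg_cst.
exact: cvg_id.
Qed.

(** * The space of chords of a metric space *)

Section Chords.
Context (R : realType) (T : topologicalType) (d : T -> T -> R).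

(** The chord from [d x] to [d y], where [d x] is the function [z |-> d x z]
    that represents the point [x]. *)
Definition chord_fun (w : T * T * R) : T -> R := fun z =>
  (1 - clamp w.2) * d w.1.1 z + clamp w.2 * d w.1.2 z.

(** Only chords are kept, not all functions: among chords the functions [d x]
    form a closed subset, although they do not in the space of all their
    bounded perturbations unless [d] is complete. *)
Definition chord of metrizes d : Type :=
  {phi : T -> R | exists w, phi = chord_fun w}.

Context (md : metrizes d).
Local Notation C := (chord md).

HB.instance Definition _ := gen_eqMixin C.
HB.instance Definition _ := gen_choiceMixin C.

Definition supdist (u v : C) : R :=
  sup (range (fun z => `|sval u z - sval v z|)).

(** A chord is at bounded distance from one of its ends, so the suprema that
    define the distance of two chords are finite even if [d] is unbounded. *)
Lemma chord_bounded (u : C) : exists y c, forall z, `|sval u z - d y z| <= c.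
Proof.
case: u => _ /= [w ->]; exists w.1.1, (d w.1.1 w.1.2) => z; rewrite /chord_fun.
have := dist_lipschitz md w.1.1 w.1.2 z; have /andP[] := clamp_itv w.2.
move: (clamp _) (d w.1.1 z) (d w.1.2 z) => t a b t0 t1; apply: le_trans.
rewrite (_ : _ - a = t * (b - a)); last by ring.
by rewrite normrM (ger0_norm t0) (distrC b a) ler_piMl.
Qed.

Lemma le_supdist (u v : C) z : `|sval u z - sval v z| <= supdist u v.
Proof.
apply: ub_le_sup; last by exists z.
have [y [c uc]] := chord_bounded u; have [y' [c' vc]] := chord_bounded v.
exists (c + c' + d y y') => _ [x _ <-].
have := uc x; have := vc x; have := dist_lipschitz md y y' x.
by rewrite !ler_norml; lra.
Qed.

Lemma supdist_le (u v : C) e :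
  (forall z, `|sval u z - sval v z| <= e) -> supdist u v <= e.
Proof.
move=> h; apply: ge_sup; last by move=> _ [x _ <-].
by have [y _] := chord_bounded u; exists `|sval u y - sval v y|, y.
Qed.

Lemma chord_eq (u v : C) : sval u =1 sval v -> u = v.
Proof. by move=> /funext; exact: eq_sig_hprop. Qed.

Lemma supdistxx u : supdist u u = 0.
Proof.
apply/eqP; rewrite eq_le supdist_le//=; last by move=> z; rewrite subrr normr0.
by have [y _] := chord_bounded u; apply: le_trans (le_supdist u u y).
Qed.

Lemma supdist_eq0 u v : supdist u v = 0 -> u = v.
Proof.
move=> uv; apply: chord_eq => z; apply/eqP; rewrite -subr_eq0 -normr_le0.
by rewrite -uv le_supdist.
Qed.

Lemma supdistC u v : supdist u v = supdist v u.
Proof. by congr sup; apply: eq_imagel => z _; rewrite distrC. Qed.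

Lemma supdist_triangle v u w : supdist u w <= supdist u v + supdist v w.
Proof.
apply: supdist_le => z; apply: le_trans (ler_distD (sval v z) _ _) _.
by apply: lerD; exact: le_supdist.
Qed.

HB.instance Definition _ := isMetric.Build R C
  supdistxx supdist_eq0 supdistC supdist_triangle.

Lemma supdist_metrizes : metrizes supdist.
Proof.
split.
- by move=> u v; split=> [|->]; [exact: supdist_eq0|exact: supdistxx].
- exact: supdistC.
- by move=> u v w; exact: supdist_triangle.
- move=> u A; have -> : nbhs u A = nbhs_ball u A by rewrite nbhs_ballE.
  by split=> -[e e0 h]; exists e => //; move: h; rewrite ballEmdist.
Qed.

End Chords.

Section ChordMaps.
Context (R : realType) (T : topologicalType) (d : T -> T -> R).
Context (md : metrizes d).
Local Notation C := (chord md).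

Definition mk_chord (w : T * T * R) : C :=
  exist _ (chord_fun d w) (ex_intro _ w erefl).

Lemma mk_chord_continuous : continuous mk_chord.
Proof.
move=> [[x y] t] A /(nbhs_dist (supdist_metrizes md))[e e0 eA].
have : \forall w \near (x, y, t), d x w.1.1 + d y w.1.2 +
    `|clamp t - clamp w.2| * d x y < e.
  have c0 : (fun w : T * T * R => d x w.1.1 + d y w.1.2 +
      `|clamp t - clamp w.2| * d x y) @ (x, y, t) -->
      d x x + d y y + `|clamp t - clamp t| * d x y.
    apply: (@cvgD R R^o); first apply: (@cvgD R R^o).
    - apply: (cvg_comp (fun w : T * T * R => (x, w.1.1)) _ _
        (@dist_continuous _ _ _ md (x, x))).
      apply: cvg_pair; first exact: cvg_cst.
      by apply: (cvg_comp fst fst); exact: cvg_fst.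
    - apply: (cvg_comp (fun w : T * T * R => (y, w.1.2)) _ _
        (@dist_continuous _ _ _ md (y, y))).
      apply: cvg_pair; first exact: cvg_cst.
      by apply: (cvg_comp fst snd); [exact: cvg_fst|exact: cvg_snd].
    - apply: (@cvgM R); last exact: cvg_cst.
      apply: (@cvg_norm _ R^o); apply: (@cvgB R R^o); first exact: cvg_cst.
      apply: (cvg_comp snd (@clamp R)); first exact: cvg_snd.
      exact: clamp_continuous.
  move: c0; rewrite !(distxx md) subrr normr0 mul0r !addr0 => c0.
  exact: (c0 [set s | s < e] (lt_nbhsl e0)).
apply: filterS => -[[x' y'] t'] /= lte; apply: eA => /=; apply: le_lt_trans lte.
apply: supdist_le => z /=; rewrite /chord_fun /=.
have := dist_lipschitz md x x' z; have := dist_lipschitz md y y' z.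
have := dist_lipschitz md x y z.
move: (clamp_itv t) (clamp_itv t') => /andP[_ _] /andP[t0 t1].
move: (clamp t) (clamp t') t0 t1 => s s' s0 s1 h1 h2 h3.
have -> : (1 - s) * d x z + s * d y z - ((1 - s') * d x' z + s' * d y' z) =
  (1 - s') * (d x z - d x' z) + s' * (d y z - d y' z) +
  - (s - s') * (d x z - d y z) by ring.
apply: le_trans (ler_normD _ _) _; apply: lerD; last first.
  by rewrite normrM normrN ler_wpM2l.
apply: le_trans (ler_normD _ _) _; apply: lerD.
  rewrite normrM ger0_norm ?subr_ge0//; apply: le_trans h3.
  by rewrite ler_piMl//; lra.
by rewrite normrM ger0_norm//; apply: le_trans h2; rewrite ler_piMl.
Qed.

Definition point_chord (x : T) : C := mk_chord (x, x, 0).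

Lemma sval_point_chord x z : sval (point_chord x) z = d x z.
Proof. by rewrite /= /chord_fun /=; ring. Qed.

Lemma mk_chord0 x y : mk_chord (x, y, 0) = point_chord x.
Proof.
apply: chord_eq => z; rewrite sval_point_chord /= /chord_fun /=.
by rewrite clamp_id ?subr0 ?mul1r ?mul0r ?addr0//; exact: unit_itv0.
Qed.

Lemma mk_chord1 x y : mk_chord (x, y, 1) = point_chord y.
Proof.
apply: chord_eq => z; rewrite sval_point_chord /= /chord_fun /=.
by rewrite clamp_id ?subrr ?mul1r ?mul0r ?add0r//; exact: unit_itv1.
Qed.

Lemma mk_chord_diag x t : mk_chord (x, x, t) = point_chord x.
Proof.
by apply: chord_eq => z; rewrite sval_point_chord /= /chord_fun /=; ring.
Qed.

(** Closedness is Wojdyslawski's argument: if [d a] is within [e] of the chord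
    [phi] from [d x] to [d y], then [phi a < e] by evaluation at [a]; but
    [phi a] is at least half the distance of [a] to one of the ends, the one
    whose weight in [phi] is at least one half. So points [d a] that approach
    [phi] approach this end. *)
Lemma point_chord_closed_embedding : closed_embedding point_chord.
Proof.
have sd x y : supdist (point_chord x) (point_chord y) <= d x y.
  by apply: supdist_le => z; rewrite !sval_point_chord dist_lipschitz.
split.
- move=> x; apply: (continuous_comp (f := fun x => (x, x, 0)) _
    (@mk_chord_continuous _)).
  apply: (@cvg_pair _ _ _ _ (nbhs (x, x)) (nbhs (0 : R))); last exact: cvg_cst.
  by apply: (@cvg_pair _ _ _ _ (nbhs x) (nbhs x)); exact: cvg_id.
- move=> x y xy; apply/esym/(dist_eq0 md).
  by rewrite -sval_point_chord -xy sval_point_chord (distxx md).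
move=> A cA phi clphi.
have near_phi e : 0 < e -> exists2 a, A a & supdist phi (point_chord a) < e.
  move=> e0; have [] := clphi _ (nbhs_dist_lt (supdist_metrizes md) phi e0).
  by move=> _ [[a Aa <-] h]; exists a.
suff [x hx] : exists x, forall e a, A a -> supdist phi (point_chord a) < e ->
    d x a < 2 * e.
  have phix : phi = point_chord x.
    apply: supdist_eq0; apply/eqP; rewrite eq_le.
    rewrite (dist_ge0 (supdist_metrizes md)) andbT; apply/ler_addgt0Pr => e e0.
    have [|a Aa ha] := near_phi (e / 3); first by lra.
    have := supdist_triangle (point_chord a) phi (point_chord x).
    by have := sd a x; have := hx _ _ Aa ha; rewrite (distC md a x); lra.
  exists x; last by [].
  apply: cA => N /(nbhs_dist md)[e e0 eN].
  have [|a Aa ha] := near_phi (e / 2); first by lra.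
  by exists a; split=> //; apply: eN => /=; have := hx _ _ Aa ha; lra.
have key e a : supdist phi (point_chord a) < e -> sval phi a < e.
  move=> lte; have := le_supdist phi (point_chord a) a.
  by rewrite sval_point_chord (distxx md) subr0 ler_norml; lra.
have [[[x y] t] phiE] := svalP phi; rewrite phiE in key.
have /andP[t0 t1] := clamp_itv t.
have [th|th] := leP (clamp t) (1 / 2).
  exists x => e a _ /key; rewrite /chord_fun /=.
  by have := dist_ge0 md y a; have := dist_ge0 md x a; nra.
exists y => e a _ /key; rewrite /chord_fun /=.
by have := dist_ge0 md y a; have := dist_ge0 md x a; nra.
Qed.

End ChordMaps.

(** * Equiconnectedness of ANRs *)

Lemma closed_embedding_within (S X Z : topologicalType) (i : X -> Z)
    (A : set S) (f : S -> X) :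
  closed_embedding i -> {within A, continuous (fun s => i (f s))} ->
  {within A, continuous f}.
Proof.
move=> [_ inj_i clo_i] /subspace_continuousP cf; apply/subspace_continuousP.
move=> s Hs N; rewrite nbhsE => -[V [oV Vs] VN].
have := cf _ Hs (~` (i @` (~` V))); rewrite /within /= !nbhs_simpl /=.
have nb : nbhs (i (f s)) (~` (i @` (~` V))).
  apply: open_nbhs_nbhs; split; first exact/closed_openC/clo_i/open_closedC.
  by move=> [x nVx /inj_i xs]; apply: nVx; rewrite xs.
move=> /(_ nb); apply: filterS => s' h As'; apply: VN; apply: contrapT => nV.
by apply: (h As'); exists (f s').
Qed.

(** Near the diagonal the chord from [d x] to [d y] stays in the open set that
    retracts to [X]; the retraction takes it to the path from [x] to [y]. *)
Lemma ANR_equiconnected (R : realType) (X : topologicalType) : ANR R X ->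
  exists (W : set (X * X)) (l : X * X * R -> X),
    [/\ open W, forall x, W (x, x), {within W `*` unit_itv R, continuous l},
        forall x y, l (x, y, 0) = x /\ l (x, y, 1) = y
      & forall x t, l (x, x, t) = x].
Proof.
move=> [[d md] /(_ _ (@point_chord R X d md))].
have ce := point_chord_closed_embedding md.
move=> /(_ (ex_intro _ _ (supdist_metrizes md)) ce).
move=> [U [r [oU AU cr rU rK]]].
(* The embedding is inverted by choice; the default value [w.1.1] only matters
   for [w] whose chord leaves [U]. *)
pose L := mk_chord md.
pose l (w : X * X * R) : X := xget w.1.1 [set x | point_chord md x = r (L w)].
have lE w x : L w = point_chord md x -> l w = x.
  move=> Lw; case: ce => _ inj_i _; apply: inj_i.
  rewrite /l; case: xgetP => [y -> ->|/(_ x) []].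
    by rewrite Lw rK//; exists x.
  by rewrite /= Lw rK//; exists x.
exists [set v | forall t, unit_itv R t -> U (L (v, t))], l.
have UL v t : U (L (v, t)) -> \forall z \near (v, t), U (L z).
  by move=> Uw; apply: mk_chord_continuous; exact: open_nbhs_nbhs.
split.
- rewrite openE => v Wv; rewrite /interior.
  apply: (@tube R (X * X)%type v (fun z => U (L z))) => t It.
  exact/UL/Wv.
- by move=> x t _; rewrite /L mk_chord_diag; apply: AU; exists x.
- apply: (closed_embedding_within ce).
  have := @within_eq (X * X * R)%type (chord md) _ (fun w => r (L w)); apply.
    move=> [v t] [/= Wv It]; rewrite /l; case: xgetP => [y -> //|].
    have [y _ yE] : range (point_chord md) (r (L (v, t))).
      by apply: rU; exists (L (v, t)) => //; exact: Wv.
    by move=> /(_ y).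
  apply: (within_comp _ _ cr).
    exact/continuous_subspaceT/mk_chord_continuous.
  by move=> [v t] [/= Wv It]; exact: Wv.
- by move=> x y; split; apply: lE; [exact: mk_chord0|exact: mk_chord1].
- by move=> x t; apply: lE; exact: mk_chord_diag.
Qed.

(** * Separation and closedness of sections *)

(** Take unions of balls around the points of each set, with half the radius
    that would keep clear of the other set. *)
Lemma metrizable_normal (R : realType) (X : topologicalType) (A C : set X) :
  metrizable R X -> closed A -> closed C -> A `&` C = set0 ->
  exists N G : set X,
    [/\ open N, open G, A `<=` N, C `<=` G & N `&` G = set0].
Proof.
move=> [d md] cA cC AC.
pose nb (P Q : set X) : set X := [set x | exists a e,
  [/\ P a, 0 < e, forall c, Q c -> 2 * e <= d a c & d a x < e]].
have nb_open P Q : open (nb P Q).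
  rewrite openE => x [a [e [Pa e0 h ax]]]; apply/(nbhs_dist md).
  exists (e - d a x); first by rewrite subr_gt0.
  move=> y /= xy; exists a, e; split => //.
  by have := dist_triangle md a x y; lra.
have nb_sub P Q : closed Q -> P `&` Q = set0 -> P `<=` nb P Q.
  move=> cQ PQ a Pa; have : nbhs a (~` Q).
    apply: open_nbhs_nbhs; split; first exact: closed_openC.
    by move=> Qa; have : (P `&` Q) a by []; rewrite PQ.
  move=> /(nbhs_dist md)[e e0 eQ]; exists a, (e / 2); rewrite (distxx md).
  split=> //; [by lra| |by lra].
  by move=> c Qc; rewrite leNgt; apply/negP => ac; apply: (eQ c) => //=; lra.
exists (nb A C), (nb C A); split => //; first exact: nb_sub.
  by apply: nb_sub; rewrite // setIC.
rewrite -subset0 => x [[a [e [Aa e0 he ax]]] [c [e' [Cc e0' he' cx]]]].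
have := he _ Cc; have := he' _ Aa; have := dist_triangle md a x c.
by rewrite (distC md x c) (distC md c a); lra.
Qed.

(** The section is the zero set of the distance from [x] to the point of the
    section in its fibre. *)
Lemma closed_section (R : realType) (B : topologicalType)
  (X : fwPointedSpace B) : metrizable R X -> closed (range (fw_sec X)).
Proof.
move=> [d md]; pose c x := d x (fw_sec X (fw_proj x)).
have -> : range (fw_sec X) = c @^-1` [set r | r = 0].
  apply/seteqP; split=> x.
    by case=> b _ <-; rewrite /c /= fw_secK (distxx md).
  by move=> /(dist_eq0 md) xE; exists (fw_proj x).
apply: closed_comp; last exact: closed_eq.
move=> x _; rewrite /c.
apply: (cvg_comp (fun x : X => (x, fw_sec X (fw_proj x))) _ _
  (@dist_continuous _ _ _ md (x, fw_sec X (fw_proj x)))).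
apply: (@cvg_pair _ _ _ _ (nbhs x) (nbhs (fw_sec X (fw_proj x)))).
  exact: cvg_id.
apply: (cvg_comp (@fw_proj _ X) (fw_sec X)); first exact: fw_proj_continuous.
exact: fw_sec_continuous.
Qed.

(** * Homotopies near the section *)

(** The homotopy sends [(x, t)] to the point obtained from [a (x, t)], on the
    path in [Y] from [f x] to [g x], by transport into the fibre of [x]. *)
Lemma local_pointed_homotopy (R : realType) (B : topologicalType)
    (X Y : fwPointedSpace B) (f g : X -> Y) :
  fw_pointed_map f -> fw_pointed_map g -> fibrant R Y -> ANR R Y ->
  exists M : set X,
    [/\ open M, range (fw_sec X) `<=` M & fw_pointed_homotopic_on R M f g].
Proof.
move=> [[cf pf] sf] [[cg pg] sg] fibY anrY.
have [W [l [oW Wd cl l01 ld]]] := ANR_equiconnected anrY.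
have [[d md] _] := anrY.
pose p := @fw_proj B Y; pose s := fw_sec Y; pose q := @fw_proj B X.
have ps b : p (s b) = b by exact: fw_secK.
have cs : continuous s by exact: fw_sec_continuous.
have cp : continuous p by exact: fw_proj_continuous.
have cq : continuous q by exact: fw_proj_continuous.
pose a (z : X * R) := l (f z.1, g z.1, z.2).
pose M1 := [set x | W (f x, g x)].
(* The end points, seen in the section of [Y], of the path in the base along
   which [a z] is to be transported. *)
pose v (z : X * R) := (s (p (a z)), s (q z.1)).
pose M := [set x | M1 x /\ forall t, unit_itv R t -> W (v (x, t))].
have ca : {within M1 `*` unit_itv R, continuous a}.
  apply: (within_comp _ _ cl); last by move=> [x t].
  apply: within_pair; last exact: within_snd.
  by apply: within_pair; apply: within_cts_comp => //; exact: within_fst.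
have cv : {within M1 `*` unit_itv R, continuous v}.
  apply: within_pair; apply: (within_cts_comp (g := s)) => //.
    exact: within_cts_comp.
  by apply: within_cts_comp => //; exact: within_fst.
have oM1 : open M1.
  apply: open_comp oW => x _.
  apply: (@cvg_pair _ _ _ _ (nbhs (f x)) (nbhs (g x))); first exact: cf.
  exact: cg.
have oM : open M.
  rewrite openE => x [M1x Mx].
  have : \forall x' \near within M1 (nbhs x), forall t, unit_itv R t ->
      W (v (x', t)).
    apply: (@within_tube R X M1 x (fun z => W (v z))) => t It.
    move/subspace_continuousP : cv => /(_ (x, t) (conj M1x It)); apply.
    by apply: open_nbhs_nbhs; split=> //; exact: Mx.
  rewrite /within /= /interior => Wx.
  have M1n : nbhs x M1 by exact: open_nbhs_nbhs.
  by apply: filterS2 M1n Wx => y M1y Wy; split=> //; exact: Wy.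
have v_sec b t : v (fw_sec X b, t) = (s b, s b).
  by rewrite /v /a /= sf sg ld -/s ps /q fw_secK.
have secM : range (fw_sec X) `<=` M.
  move=> _ [b _ <-]; split; first by rewrite /M1 /= sf sg.
  by move=> t It; rewrite v_sec.
exists M; split=> //.
have M1M z : (M `*` unit_itv R) z -> (M1 `*` unit_itv R) z by move=> [[]].
have caM := continuous_subspaceW M1M ca.
have cvM := continuous_subspaceW M1M cv.
(* [delta] vanishes exactly where [a z] already lies in the fibre of [z.1], in
   particular at the times 0 and 1 and over the section. *)
pose delta z := Num.min 1 (d (v z).1 (v z).2).
pose H (w : X * R * R) := p (l (v w.1, w.2)).
have delta0 z : delta z = 0 -> (v z).1 = (v z).2.
  rewrite /delta /Num.min; case: ifP => _ h; last exact: (dist_eq0 md).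
  by have := @oner_neq0 R; rewrite h eqxx.
have [] := @regular_lift R Y B (X * R)%type p (M `*` unit_itv R) delta a H fibY.
- apply/subspace_continuousP => z Az.
  apply: (@continuous2_cvg _ R R R).
  + exact: (@min_continuous _ R (1, _)).
  + exact: cvg_cst.
  move/subspace_continuousP : (within_cts_comp cvM (dist_continuous md)).
  exact.
- move=> z _; apply/unit_itvP.
  by rewrite le_min ler01 (dist_ge0 md) ge_min lexx.
- exact: caM.
- apply: within_cts_comp => //; apply: (within_comp _ _ cl); last first.
    by move=> [[x t] u] [/= [[_ Mx] It] Iu]; split=> //; exact: Mx.
  apply: within_pair; last exact: within_snd.
  have := @within_comp _ _ _ ((M `*` unit_itv R) `*` unit_itv R) _ fst v.
  by apply; [exact: within_fst| |exact: cvM] => w [].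
- by move=> z _; rewrite /H /v /=; have [-> _] := l01 (s (p (a z))) (s (q z.1)).
- by move=> z t _ It /delta0; rewrite /v /H /v /= => <-; rewrite ld ps.
move=> K [cK K0 pK Kst].
exists (fun z => K (z, 1)); split; last first.
  move=> b t It; rewrite Kst.
  - by rewrite /a /= sf sg ld.
  - by split=> //; apply: secM; exists b.
  - exact: unit_itv1.
  - by rewrite /delta v_sec (distxx md) min_r.
split.
- apply: (within_comp _ _ cK).
    apply: within_pair; apply: continuous_subspaceT => z; first exact: cvg_id.
    exact: cvg_cst.
  by move=> z Az; split=> //; exact: unit_itv1.
- move=> x Mx; rewrite Kst//; [|split=> //; exact: unit_itv0|exact: unit_itv1|].
  + by rewrite /a; have [-> _] := l01 (f x) (g x).
  + rewrite /delta /v /a /=; have [-> _] := l01 (f x) (g x).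
    by rewrite /p pf (distxx md) min_r.
- move=> x Mx; rewrite Kst//; [|split=> //; exact: unit_itv1|exact: unit_itv1|].
  + by rewrite /a; have [_ ->] := l01 (f x) (g x).
  + rewrite /delta /v /a /=; have [_ ->] := l01 (f x) (g x).
    by rewrite /p pg (distxx md) min_r.
- move=> x t Mx It; rewrite /= -/p pK//; last exact: unit_itv1.
  by rewrite /H; rewrite /v /=; have [_ ->] := l01 (s (p (a (x, t)))) (s (q x)).
Qed.

Lemma pointed_homotopic_glue (R : realType) (B : topologicalType)
    (X Y : fwPointedSpace B) (f g : X -> Y) (U M N G : set X) :
  open N -> open G -> N `&` G = set0 -> range (fw_sec X) `<=` N -> N `<=` M ->
  fw_pointed_homotopic_on R M f g -> fw_homotopic_on R U f g ->
  fw_pointed_homotopic_on R ((U `&` G) `|` N) f g.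
Proof.
move=> oN oG NG sN NM [HM [[cM M0 M1 pM] sM]] [HU [cU U0 U1 pU]].
pose H (z : X * R) := if `[< N z.1 >] then HM z else HU z.
have HN x t : N x -> H (x, t) = HM (x, t) by move=> Nx; rewrite /H asboolT.
have HG x t : ~ N x -> H (x, t) = HU (x, t) by move=> nNx; rewrite /H asboolF.
have GN x : G x -> ~ N x by move=> Gx Nx; have : (N `&` G) x by []; rewrite NG.
exists H; split; last by move=> b t It; rewrite HN ?sM//; apply: sN; exists b.
split.
- apply/subspace_continuousP => -[x t] [/= UGN It] Q; rewrite /from_subspace.
  have openX (A : set X) : open A -> A x -> nbhs (x, t) [set z : X * R | A z.1].
    move=> oA Ax; exists (A, setT); last by move=> z [].
    by split; [exact: open_nbhs_nbhs|exact: filterT].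
  have [Nx|nNx] := pselect (N x).
    rewrite HN// => QM; move/subspace_continuousP : cM.
    move=> /(_ (x, t) (conj (NM _ Nx) It) Q QM).
    rewrite /within /= !nbhs_simpl /=.
    apply: filterS2 (openX _ oN Nx) => -[y u] /= Ny h [_ Iu].
    by rewrite HN//; apply: h; split=> //; exact: NM.
  case: UGN => // -[Ux Gx]; rewrite HG// => QU.
  move/subspace_continuousP : cU => /(_ (x, t) (conj Ux It) Q QU).
  rewrite /within /= !nbhs_simpl /=.
  apply: filterS2 (openX _ oG Gx) => -[y u] /= Gy h [UGN Iu].
  rewrite HG; last exact: GN.
  by apply: h; split=> //; case: UGN => [[]//|/(GN _ Gy)].
- move=> x UGN; have [Nx|nNx] := pselect (N x).
    by rewrite HN// M0//; exact: NM.
  by rewrite HG// U0//; case: UGN => [[]//|/nNx].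
- move=> x UGN; have [Nx|nNx] := pselect (N x).
    by rewrite HN// M1//; exact: NM.
  by rewrite HG// U1//; case: UGN => [[]//|/nNx].
- move=> x t UGN It; have [Nx|nNx] := pselect (N x).
    by rewrite HN// pM//; exact: NM.
  by rewrite HG// pU//; case: UGN => [[]//|/nNx].
Qed.

(** * The inequalities *)

Lemma least_or_infty_le (R : realType) (P Q : nat -> Prop) :
  (forall n, P n -> Q n) -> (least_or_infty R Q <= least_or_infty R P)%E.
Proof.
move=> PQ; rewrite /least_or_infty.
case: (pselect (exists n, `[< P n >])) => [exP|nP]; last by rewrite leey.
case: pselect => [exQ|]; last first.
  by case; case: exP => n /asboolP /PQ /asboolT Qn; exists n.
case: ex_minnP => m _ m_min; case: ex_minnP => n /asboolP /PQ /asboolT Qn _.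
by rewrite lee_fin ler_nat; exact: m_min.
Qed.

Lemma least_or_infty_shift (R : realType) (P Q : nat -> Prop) :
  (forall n, P n -> Q n.+1) -> (least_or_infty R Q <= least_or_infty R P + 1)%E.
Proof.
move=> PQ; rewrite /least_or_infty.
case: (pselect (exists n, `[< P n >])) => [exP|nP]; last by rewrite leey.
case: pselect => [exQ|]; last first.
  by case; case: exP => n /asboolP /PQ /asboolT Qn; exists n.+1.
case: ex_minnP => m _ m_min; case: ex_minnP => n /asboolP /PQ /asboolT Qn _.
by rewrite -EFinD lee_fin natr1 ler_nat; exact: m_min.
Qed.

Theorem theorem8p5 (R : realType) (B : topologicalType)
    (X Y : fwPointedSpace B) (f g : X -> Y)
    (hf : fw_pointed_map f) (hg : fw_pointed_map g)
    (fibX : fibrant R X) (fibY : fibrant R Y)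
    (anrX : ANR R X) (anrY : ANR R Y) (lecB : LEC R B) :
  (fw_distance R f g <= fw_pointed_distance R f g)%E /\
  (fw_pointed_distance R f g <= fw_distance R f g + 1)%E.
Proof.
split.
  apply: least_or_infty_le => n [U [cU hU]]; exists U; split=> // i.
  by have [_ [H [HU _]]] := hU i; exists H.
apply: least_or_infty_shift => n [U [[oU covU] hU]].
have [M [oM sM hM]] := local_pointed_homotopy hf hg fibY anrY.
have [] := @metrizable_normal R X (range (fw_sec X)) (~` M) (proj1 anrX).
- exact: closed_section (proj1 anrX).
- exact: open_closedC.
- by rewrite -subset0 => x [/sM].
move=> N [G [oN oG sN MG NG]].
have NM : N `<=` M.
  move=> x Nx; apply: contrapT => /MG Gx.
  by have : (N `&` G) x by []; rewrite NG.
exists (fun i => if unlift ord0 i is Some j then (U j `&` G) `|` N else M).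
split; first split.
- by move=> i; case: unliftP => [j|] _ //; apply: openU => //; exact: openI.
- rewrite -subTset => x _; have [Mx|nMx] := pselect (M x).
    by exists ord0 => //; rewrite unlift_none.
  have : (\bigcup_i U i) x by rewrite covU.
  case=> j _ Ux; exists (lift ord0 j) => //; rewrite liftK; left.
  by split=> //; exact: MG.
- move=> i; case: unliftP => [j|] _; last by [].
  split; first by move=> x /sN; right.
  exact: (pointed_homotopic_glue oN oG NG sN NM hM (hU j)).
Qed.
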